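(* Let $\mathcal{H}\neq\{0\}$ be a complex separable Hilbert space and let $\Phi=(\phi_n)_{n=1}^\infty$ be a frame for $\mathcal{H}$. Then the following statements hold. \begin{itemize} \item[(i)] The closure in $\ell^2$ of the union of all sets $\mathcal{R}(U_{\Phi^d})$, where $\Phi^d$ runs through all dual frames of $\Phi$, is $\ell^2$. \item[(ii)] Let $\Psi=(\psi_n)_{n=1}^\infty$ be a frame for $\mathcal{H}$. If every dual frame $\Phi^d$ of $\Phi$ is a dual frame of $\Psi$, then $\Psi=\Phi$. \end{itemize}
   Context: A sequence $\Phi=(\phi_n)_{n=1}^\infty$ in $\mathcal{H}$ is a frame for $\mathcal{H}$ if there are $0<A\le B<\infty$ with $A\|h\|^2\le\sum_n|\langle h,\phi_n\rangle|^2\le B\|h\|^2$ for all $h\in\mathcal{H}$. A dual frame of a frame $\Phi$ is a frame $\Phi^d=(\phi^d_n)$ for $\mathcal{H}$ with $h=\sum_n\langle h,\phi^d_n\rangle\phi_n$ for all $h\in\mathcal{H}$. For a frame $\Phi$, the analysis operator is $U_\Phi:\mathcal{H}\to\ell^2$, $U_\Phi h=(\langle h,\phi_n\rangle)_{n=1}^\infty$, and $\mathcal{R}(U_\Phi)\subseteq\ell^2$ denotes its range. Here $\ell^2=\ell^2(\mathbb{N})$. *)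

(* Defs.v *)
From HB Require Import structures.
From mathcomp Require Import all_boot all_order all_algebra.
From mathcomp Require Import complex.
From mathcomp Require Import all_classical all_reals all_analysis.
From mathcomp Require Import ring lra.

Set Implicit Arguments.
Unset Strict Implicit.
Unset Printing Implicit Defensive.

Import Order.TTheory GRing.Theory Num.Theory.
Import numFieldNormedType.Exports.

Local Open Scope classical_set_scope.
Local Open Scope ring_scope.
Local Open Scope complex_scope.

(* Norms over R[i] take values in R[i]; this is the same norm as a real. *)
Definition rnorm (R : realType) (V : normedZmodType R[i]) (x : V) : R :=
  complex.Re `|x|.

Section RNorm.
Variables (R : realType) (V : normedZmodType R[i]).
Implicit Types x y : V.

Lemma rnormE x : (rnorm x)%:C = `|x|.
Proof.
rewrite /rnorm; have := normr_ge0 x; case: `|x| => a b.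
by rewrite lecE /= => /andP[/eqP -> _].
Qed.

Lemma rnorm_ge0 x : 0 <= rnorm x.
Proof. by rewrite -lecR rnormE normr_ge0. Qed.

Lemma rnorm0 : rnorm (0 : V) = 0.
Proof. by rewrite /rnorm normr0. Qed.

Lemma rnorm_eq0 x : rnorm x = 0 -> x = 0.
Proof. by move=> x0; apply/normr0_eq0; rewrite -rnormE x0. Qed.

Lemma rnormN x : rnorm (- x) = rnorm x.
Proof. by rewrite /rnorm normrN. Qed.

Lemma rnormD x y : rnorm (x + y) <= rnorm x + rnorm y.
Proof. by rewrite -lecR rmorphD /= !rnormE ler_normD. Qed.

End RNorm.

Lemma rnormM (R : realType) (a b : R[i]) : rnorm (a * b) = rnorm a * rnorm b.
Proof. by apply: complexI; rewrite rmorphM /= !rnormE normrM. Qed.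

(* The sum of |c n|^2, in [0, +oo]. *)
Definition sqsum (R : realType) (c : nat -> R[i]) : \bar R :=
  (\sum_(n <oo) ((rnorm (c n)) ^+ 2)%:E)%E.

Section SqSum.
Variable R : realType.
Implicit Types c d : nat -> R[i].

Let sq_ge0 c n : (0 <= ((rnorm (c n)) ^+ 2)%:E)%E.
Proof. by rewrite lee_fin sqr_ge0. Qed.

Lemma sqsum_ge0 c : (0 <= sqsum c)%E.
Proof. exact: nneseries_ge0. Qed.

Lemma sqsum0 : sqsum (0 : nat -> R[i]) = 0%E.
Proof. by rewrite /sqsum eseries0// => n _ _; rewrite rnorm0 expr0n. Qed.

Lemma sqsum_eq0 c : sqsum c = 0%E -> c = 0.
Proof.
move=> c0; apply/funext => n; apply: rnorm_eq0.
have : (((rnorm (c n)) ^+ 2)%:E <= 0)%E.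
  rewrite -c0 /sqsum (@nneseriesD1 _ _ n)//.
  by rewrite leeDl// nneseries_ge0.
by rewrite lee_fin real_exprn_even_le0//= => /eqP.
Qed.

Lemma sqsumZ (a : R[i]) c :
  sqsum (fun n => a * c n) = (((rnorm a) ^+ 2)%:E * sqsum c)%E.
Proof.
rewrite /sqsum -nneseriesZl//; apply: eq_eseriesr => n _.
by rewrite rnormM exprMn EFinM.
Qed.

Lemma sqsumD_weighted c d (a b : R) : 0 < a -> 0 < b ->
  (sqsum (c + d)%R
    <= ((a + b) / a)%:E * sqsum c + ((a + b) / b)%:E * sqsum d)%E.
Proof.
move=> a0 b0; have ab0 : 0 < a + b by rewrite addr_gt0.
rewrite /sqsum -!nneseriesZl// -nneseriesD; last 2 first.
- by move=> n _ _; rewrite mule_ge0// lee_fin divr_ge0 ?ltW.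
- by move=> n _ _; rewrite mule_ge0// lee_fin divr_ge0 ?ltW.
apply: lee_nneseries => // n _; rewrite -!EFinM -EFinD lee_fin.
rewrite -[(c + d) n]/(c n + d n); set u := rnorm (c n); set v := rnorm (d n).
apply: (@le_trans _ _ ((u + v) ^+ 2)).
  by rewrite ler_sqr ?nnegrE ?rnormD// ?addr_ge0// ?rnorm_ge0.
rewrite -subr_ge0 (_ : _ - _ = (b * u - a * v) ^+ 2 / (a * b)).
  by rewrite divr_ge0 ?sqr_ge0// mulr_ge0// ltW.
by field; rewrite !gt_eqF.
Qed.

End SqSum.

Definition is_l2 (R : realType) : pred (nat -> R[i]) :=
  fun c => (sqsum c < +oo)%E.

Section L2Closed.
Variable R : realType.

Lemma is_l2_zmod_closed : zmod_closed (@is_l2 R).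
Proof.
split=> [|c d]; rewrite !unfold_in /is_l2; first by rewrite sqsum0 ltry.
move=> c2 d2; apply: le_lt_trans (@sqsumD_weighted _ c (- d) 1 1 _ _) _ => //.
rewrite (_ : sqsum (- d) = sqsum d); last first.
  by apply: eq_eseriesr => n _; rewrite -[(- d) n]/(- d n) rnormN.
rewrite lte_add_pinfty// lte_mul_pinfty// ?sqsum_ge0 ?lee_fin//.
Qed.

HB.instance Definition _ :=
  GRing.isZmodClosed.Build _ (@is_l2 R) is_l2_zmod_closed.

End L2Closed.

Record l2 (R : realType) := L2 { l2_seq :> nat -> R[i]; _ : is_l2 l2_seq }.

HB.instance Definition _ (R : realType) := [isSub for @l2_seq R].
HB.instance Definition _ (R : realType) := [Choice of l2 R by <:].
HB.instance Definition _ (R : realType) :=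
  [SubChoice_isSubZmodule of l2 R by <:].

Section L2Normed.
Variable R : realType.
Implicit Types x y : l2 R.

Lemma l2P x : (sqsum x < +oo)%E.
Proof. by case: x. Qed.

Lemma l2Z_subproof (a : R[i]) x : is_l2 (fun n => a * x n).
Proof.
rewrite /is_l2 sqsumZ lte_mul_pinfty ?lee_fin ?sqr_ge0//; exact: l2P.
Qed.

Definition l2_scale (a : R[i]) x : l2 R := L2 (l2Z_subproof a x).

Fact l2_scaleA a b x : l2_scale a (l2_scale b x) = l2_scale (a * b) x.
Proof. by apply/val_inj/funext => n /=; rewrite mulrA. Qed.
Fact l2_scale1 : left_id 1 l2_scale.
Proof. by move=> x; apply/val_inj/funext => n /=; rewrite mul1r. Qed.
Fact l2_scaleDr : right_distributive l2_scale +%R.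
Proof. by move=> a x y; apply/val_inj/funext => n /=; exact: mulrDr. Qed.
Fact l2_scaleDl x : {morph l2_scale^~ x : a b / a + b}.
Proof. by move=> a b; apply/val_inj/funext => n /=; exact: mulrDl. Qed.

HB.instance Definition _ := GRing.Zmodule_isLmodule.Build R[i] (l2 R)
  l2_scaleA l2_scale1 l2_scaleDr l2_scaleDl.

Definition l2_norm x : R := Num.sqrt (fine (sqsum x)).

Lemma l2_normE x : ((l2_norm x ^+ 2)%:E = sqsum x)%E.
Proof.
rewrite sqr_sqrtr ?fine_ge0 ?sqsum_ge0// fineK// ge0_fin_numE ?sqsum_ge0//.
exact: l2P.
Qed.

Lemma l2_norm_eq0 x : l2_norm x = 0 -> x = 0.
Proof.
move=> x0; apply/val_inj/sqsum_eq0.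
by rewrite -l2_normE x0 expr0n.
Qed.

Lemma l2_normZ a x : l2_norm (a *: x) = rnorm a * l2_norm x.
Proof.
apply/eqP; rewrite -(@eqrXn2 _ 2)// ?mulr_ge0 ?rnorm_ge0 ?sqrtr_ge0//.
by rewrite -eqe l2_normE sqsumZ -l2_normE exprMn.
Qed.

Lemma l2_normD x y : l2_norm (x + y) <= l2_norm x + l2_norm y.
Proof.
have [/l2_norm_eq0 ->|x0] := eqVneq (l2_norm x) 0.
  by rewrite add0r lerDr sqrtr_ge0.
have [/l2_norm_eq0 ->|y0] := eqVneq (l2_norm y) 0.
  by rewrite addr0 lerDl sqrtr_ge0.
have {}x0 : 0 < l2_norm x by rewrite lt_neqAle eq_sym x0 sqrtr_ge0.
have {}y0 : 0 < l2_norm y by rewrite lt_neqAle eq_sym y0 sqrtr_ge0.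
rewrite -ler_sqr ?nnegrE ?addr_ge0 ?sqrtr_ge0// -lee_fin l2_normE.
apply: le_trans (sqsumD_weighted x y x0 y0) _.
rewrite -!l2_normE -!EFinM -EFinD lee_fin le_eqVlt; apply/orP; left.
by apply/eqP; field; rewrite !gt_eqF.
Qed.

Definition l2_normC x : R[i] := (l2_norm x)%:C.

Fact l2_normCD x y : l2_normC (x + y) <= l2_normC x + l2_normC y.
Proof. by rewrite -rmorphD lecR l2_normD. Qed.
Fact l2_normCZ a x : l2_normC (a *: x) = `|a| * l2_normC x.
Proof. by rewrite /l2_normC l2_normZ rmorphM /= rnormE. Qed.
Fact l2_normC_eq0 x : l2_normC x = 0 -> x = 0.
Proof. by move=> x0; apply/l2_norm_eq0/complexI. Qed.

HB.instance Definition _ := Lmodule_isNormed.Build R[i] (l2 R)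
  l2_normCD l2_normCZ l2_normC_eq0.

End L2Normed.

Section Frames.
Variables (R : realType) (H : completeNormedModType R[i]).
(* Linear in the first argument, conjugate-linear in the second one. *)
Variable dot : {dot H for (@Num.conj R[i])}.

Definition coefs (phi : nat -> H) (h : H) : nat -> R[i] :=
  fun n => dot h (phi n).

Definition is_frame (phi : nat -> H) : Prop :=
  exists A B : R, [/\ 0 < A, A <= B & forall h : H,
    ((A * rnorm h ^+ 2)%:E <= sqsum (coefs phi h) <= (B * rnorm h ^+ 2)%:E)%E].

Definition is_dual_frame (phi phid : nat -> H) : Prop :=
  is_frame phid /\
  forall h : H, series (fun n => dot h (phid n) *: phi n) @ \oo --> h.

(* The zero default of insubd is never used when phi is a frame:
   see analysisE. *)
Definition analysis (phi : nat -> H) (h : H) : l2 R :=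
  insubd (0 : l2 R) (coefs phi h).

Lemma analysisE phi h : is_frame phi ->
  l2_seq (analysis phi h) = fun n => dot h (phi n).
Proof.
move=> [A [B [_ _ /(_ h)/andP[_ hB]]]].
by rewrite -[LHS]/(val _) val_insubd /is_l2 (le_lt_trans hB (ltry _)).
Qed.

End Frames.

(* Main.v *)
Require Import Defs.
From HB Require Import structures.
From mathcomp Require Import all_boot all_order all_algebra.
From mathcomp Require Import complex.
From mathcomp Require Import all_classical all_reals all_analysis.
From mathcomp Require Import ring lra.

Import Order.TTheory GRing.Theory Num.Theory.
Import numFieldNormedType.Exports.

Local Open Scope classical_set_scope.
Local Open Scope ring_scope.
Local Open Scope complex_scope.

(* Let S be the frame operator of phi, which is invertible.  If c is
   square-summable and sum_k c_k phi_k = h0 <> 0, then with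
   d = c - U (S^-1 h0), whose synthesis is 0, the sequence
   phid_n = S^-1 phi_n + conj(d_n) / |h0|^2 h0 is a dual frame of phi with
   <h0, phid_n> = c_n.  So the ranges of the analysis operators of the dual
   frames cover everything outside the kernel of the synthesis operator, a
   dense set, and the synthesis operators of phi and psi agree outside this
   kernel, in particular on suitable finite combinations of unit vectors. *)

(** * Real-valued norms and convergence *)

Lemma rnorm_sum (R : realType) (V : normedZmodType R[i]) m n
    (u : nat -> V) :
  rnorm (\sum_(m <= k < n) u k) <= \sum_(m <= k < n) rnorm (u k).
Proof.
rewrite -lecR rnormE rmorph_sum /=.
under [leRHS]eq_bigr do rewrite rnormE.
exact: ler_norm_sum.
Qed.

Lemma rnorm_gt0 (R : realType) (V : normedZmodType R[i]) (x : V) :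
  x != 0 -> 0 < rnorm x.
Proof.
move=> x0; rewrite lt_def rnorm_ge0 andbT.
by apply: contra x0 => /eqP/rnorm_eq0/eqP.
Qed.

Section RealNorm.
Variables (R : realType) (V : normedModType R[i]).
Implicit Types (u : nat -> V) (l x y : V).

Lemma rnormZ (a : R[i]) x : rnorm (a *: x) = rnorm a * rnorm x.
Proof. by apply: complexI; rewrite rmorphM /= !rnormE normrZ. Qed.

Lemma gt0_complexP (e : R[i]) : 0 < e -> exists2 r : R, 0 < r & e = r%:C.
Proof.
by case: e => a b; rewrite ltcE /= => /andP[/eqP -> a0]; exists a.
Qed.

(** A positive element of [R[i]] is real, so the complex radii of the topology can be traded for
    real ones; later estimates then stay in [R]. *)
Lemma cvg_rnormP u l :
  u @ \oo --> l <-> (fun n => rnorm (l - u n)) @ \oo --> (0 : R).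
Proof.
split.
- move=> /cvgrPdist_lt ul; apply/cvgrPdist_lt => e e0.
  have /ul : 0 < e%:C by rewrite ltcR.
  apply: filterS => n; rewrite -rnormE ltcR sub0r normrN.
  by rewrite ger0_norm ?rnorm_ge0.
- move=> /cvgrPdist_lt ul; apply/cvgrPdist_lt => _ /gt0_complexP[r r0 ->].
  move/ul : r0; apply: filterS => n; rewrite -rnormE ltcR sub0r normrN.
  by rewrite ger0_norm ?rnorm_ge0.
Qed.

Lemma ler_dist_rnorm x y : `|rnorm x - rnorm y| <= rnorm (x - y).
Proof.
have h a b : rnorm a - rnorm b <= rnorm (a - b).
  by rewrite lerBlDr; have := rnormD (a - b) b; rewrite subrK.
by rewrite ler_norml h andbT lerNl opprB -(rnormN (x - y)) opprB h.
Qed.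

Lemma cvg_rnorm u l :
  u @ \oo --> l -> (fun n => rnorm (u n)) @ \oo --> rnorm l.
Proof.
move=> /cvg_rnormP ul; apply/cvgrPdist_lt => e e0.
move/cvgrPdist_lt : ul => /(_ _ e0); apply: filterS => n.
rewrite sub0r normrN ger0_norm ?rnorm_ge0//; apply: le_lt_trans.
exact: ler_dist_rnorm.
Qed.

End RealNorm.

(** Cauchy criterion in a complete space. The free exponent serves two uses: first powers for the
    Neumann series, squares for the synthesis series. *)
Lemma is_cvg_series_dominated (R : realType) (V : completeNormedModType R[i])
    (u : nat -> V) (a : nat -> R) (p : nat) (K : R) :
  cvgn (series a) -> 0 < K ->
  (forall m n, rnorm (\sum_(m <= k < n) u k) ^+ p.+1
               <= K * \sum_(m <= k < n) a k) ->
  cvgn (series u).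
Proof.
move=> /cauchy_cvgP/cauchy_seriesP ca K0 ua.
apply/cauchy_cvgP/cauchy_seriesP => _ /gt0_complexP[r r0 ->].
have /ca : 0 < r ^+ p.+1 / K by rewrite divr_gt0// exprn_gt0.
apply: filterS => -[m n] /= mn; rewrite -rnormE ltcR.
rewrite -(@ltr_pXn2r _ p.+1)// ?nnegrE ?rnorm_ge0 ?(ltW r0)//.
apply: le_lt_trans (ua m n) _; rewrite mulrC -ltr_pdivlMr//.
exact: le_lt_trans (ler_norm _) mn.
Qed.

(** * Square-summable sequences and multiples of unit vectors *)

Section SquareSum.
Variable R : realType.
Implicit Types (c : nat -> R[i]) (M : R).

Lemma sqsum_geP c m n :
  ((\sum_(m <= k < n) rnorm (c k) ^+ 2)%:E <= sqsum c)%E.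
Proof.
have [mn|nm] := leqP m n; last first.
  by rewrite big_geq ?(ltnW nm)// sqsum_ge0.
apply: le_trans (@nneseries_lim_ge _ _ xpredT _ n _); last first.
  by move=> k _ _; rewrite lee_fin sqr_ge0.
rewrite sumEFin lee_fin [leRHS](big_cat_nat (n := m))//= lerDr.
by apply: sumr_ge0 => k _; exact: sqr_ge0.
Qed.

Lemma sqsum_is_cvg c : (sqsum c < +oo)%E ->
  cvgn (series (fun k => rnorm (c k) ^+ 2)).
Proof.
move=> c2; apply: nondecreasing_is_cvgn.
  by apply: nondecreasing_series => n _ _; exact: sqr_ge0.
exists (fine (sqsum c)) => _ [n _ <-].
by rewrite -lee_fin fineK ?sqsum_geP// ge0_fin_numE ?sqsum_ge0.
Qed.

Lemma sqsum_lim c l :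
  series (fun k => rnorm (c k) ^+ 2) @ \oo --> l -> sqsum c = l%:E.
Proof.
move=> cl; rewrite /sqsum; apply/cvg_lim => //.
under eq_fun do rewrite sumEFin.
by apply: cvg_EFin; [exact: nearW|exact: cl].
Qed.

Definition delta (m : nat) (a : R[i]) : nat -> R[i] :=
  fun k => if k == m then a else 0.

Lemma cvg_series_single (V : normedModType R[i]) (u : nat -> V) m :
  (forall k, k != m -> u k = 0) -> series u @ \oo --> u m.
Proof.
move=> um; apply: cvg_near_cst; exists m.+1 => // n /= mn.
rewrite /series /= (bigD1_seq m) ?iota_uniq ?mem_index_iota//=.
by rewrite big1 ?addr0.
Qed.

Lemma cvg_synth_delta (V : normedModType R[i]) (phi : nat -> V) m a :
  series (fun k => delta m a k *: phi k) @ \oo --> a *: phi m.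
Proof.
rewrite [X in _ --> X *: _](_ : a = delta m a m); last by rewrite /delta eqxx.
by apply: cvg_series_single => k /negbTE km; rewrite /delta km scale0r.
Qed.

Lemma sqsum_delta m a : sqsum (delta m a) = (rnorm a ^+ 2)%:E.
Proof.
rewrite /sqsum (@nneseriesD1 _ _ m)//; last first.
  by move=> k _; rewrite lee_fin sqr_ge0.
rewrite eseries0 ?adde0 ?/delta ?eqxx// => k _ /negbTE ->.
by rewrite rnorm0 expr0n.
Qed.

End SquareSum.

(** * Inner product: Cauchy-Schwarz and continuity *)

Section Hilbert.
Variables (R : realType) (H : completeNormedModType R[i]).
Variable dot : {dot H for (@Num.conj R[i])}.
Hypothesis norm_dot : forall h : H, `|h| ^+ 2 = dot h h.
Implicit Types (x y z g h : H) (u v : nat -> H) (c : nat -> R[i]).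

Lemma dotC x y : dot x y = Num.conj (dot y x).
Proof. by rewrite (hermC dot x y) expr0 mul1r. Qed.

Lemma rnorm_dotC x y : rnorm (dot x y) = rnorm (dot y x).
Proof. by rewrite dotC /rnorm norm_conjC. Qed.

Lemma dotDr x y z : dot x (y + z) = dot x y + dot x z.
Proof. exact: linearDr. Qed.

Lemma dotZr (a : R[i]) x y : dot x (a *: y) = Num.conj a * dot x y.
Proof. exact: linearZr_LR. Qed.

Lemma dotZl (a : R[i]) x y : dot (a *: x) y = a * dot x y.
Proof. exact: linearZl_LR. Qed.

Lemma dotBl x y z : dot (x - y) z = dot x z - dot y z.
Proof. exact: linearBl. Qed.

Lemma dotBr x y z : dot z (x - y) = dot z x - dot z y.
Proof. exact: linearBr. Qed.

Lemma dot_suml m n u y :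
  dot (\sum_(m <= k < n) u k) y = \sum_(m <= k < n) dot (u k) y.
Proof.
apply: (big_morph (dot^~ y)) => [a b|]; first exact: linearDl.
exact: linear0l.
Qed.

Lemma rnorm_sqE x : (rnorm x ^+ 2)%:C = dot x x.
Proof. by rewrite rmorphXn /= rnormE norm_dot. Qed.

Lemma Re_conjC (a : R[i]) : complex.Re (Num.conj a) = complex.Re a.
Proof. by case: a. Qed.

Lemma ReD (a b : R[i]) : complex.Re (a + b) = complex.Re a + complex.Re b.
Proof. by case: a; case: b. Qed.

Lemma ReN (a : R[i]) : complex.Re (- a) = - complex.Re a.
Proof. by case: a. Qed.

Lemma ReZ (r : R) (a : R[i]) : complex.Re (r%:C * a) = r * complex.Re a.
Proof. by case: a => s t /=; rewrite mul0r subr0. Qed.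

Lemma le_Re_rnorm (a : R[i]) : `|complex.Re a| <= rnorm a.
Proof. by rewrite -lecR rnormE normc_ge_Re. Qed.

(** For real [t] the two cross terms are conjugate and merge into one real part. Both Cauchy-Schwarz
    and the contraction estimate start from this expansion. *)
Lemma rnormBZ_sq (t : R) x y :
  rnorm (x - t%:C *: y) ^+ 2 =
  rnorm x ^+ 2 - 2 * t * complex.Re (dot y x) + t ^+ 2 * rnorm y ^+ 2.
Proof.
have rE z : rnorm z ^+ 2 = complex.Re (dot z z) by rewrite -rnorm_sqE.
have tE : Num.conj t%:C = t%:C :> R[i].
  by apply/eqP; rewrite eq_complex /= oppr0 !eqxx.
have ReC : complex.Re (dot x y) = complex.Re (dot y x).
  by rewrite dotC Re_conjC.
rewrite !rE dnormB !(dotZl, dotZr) tE !(ReD, ReN, Re_conjC, ReZ) ReC.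
by ring.
Qed.

Lemma rnorm_dot x y : rnorm (dot x y) <= rnorm x * rnorm y.
Proof.
have [->|y0] := eqVneq y 0.
  by rewrite dotC linear0l rmorph0 !rnorm0 mulr0.
have {}y0 := rnorm_gt0 _ _ _ y0.
rewrite -(@ler_pXn2r _ 2)// ?nnegrE ?mulr_ge0 ?rnorm_ge0// exprMn.
(* [t w y] is the orthogonal projection of [x] on [y], so the square below is that of the remaining
   component. *)
set w := dot x y; set t := (rnorm y ^+ 2)^-1.
have := sqr_ge0 (rnorm (x - t%:C *: (w *: y))).
rewrite rnormBZ_sq dotZl [dot y x]dotC -/w.
have -> : complex.Re (w * Num.conj w) = rnorm w ^+ 2.
  by rewrite -normCK -rnormE -rmorphXn.
rewrite rnormZ exprMn -subr_ge0.
rewrite (_ : _ + _ = (rnorm x ^+ 2 * rnorm y ^+ 2 - rnorm w ^+ 2) * t).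
  by rewrite pmulr_lge0// invr_gt0 exprn_gt0.
by rewrite /t; field; rewrite gt_eqF.
Qed.

(** By Cauchy-Schwarz the defect at the limit is at most |l - u_n| |y| + |x| |l' - v_n|, which tends
    to 0. This carries self-adjointness from partial sums to the frame operator. *)
Lemma dot_lim_eq u v l l' x y :
  u @ \oo --> l -> v @ \oo --> l' ->
  (forall n, dot (u n) y = dot x (v n)) -> dot l y = dot x l'.
Proof.
move=> /cvg_rnormP ul /cvg_rnormP vl' uv.
apply/eqP; rewrite -subr_eq0; apply/eqP/rnorm_eq0/eqP.
rewrite eq_le rnorm_ge0 andbT.
have lim0 : (fun n => rnorm (l - u n) * rnorm y + rnorm x * rnorm (l' - v n))
    @ \oo --> (0 : R).
  rewrite -(addr0 0) -[X in X + _](mul0r (rnorm y)).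
  rewrite -[X in _ + X](mulr0 (rnorm x)).
  by apply: cvgD; [apply: cvgMr_tmp|apply: cvgMl_tmp].
rewrite -(cvg_lim _ lim0)//; apply: limr_ge; first exact/cvg_ex/(ex_intro _ 0).
apply: nearW => n.
rewrite (_ : _ - _ = dot (l - u n) y - dot x (l' - v n)).
  apply: le_trans (rnormD _ _) _; rewrite rnormN.
  by apply: lerD; exact: rnorm_dot.
by rewrite dotBl dotBr uv; ring.
Qed.

Lemma cvg_Re_dot u l y :
  u @ \oo --> l ->
  (fun n => complex.Re (dot (u n) y)) @ \oo --> complex.Re (dot l y).
Proof.
move=> /cvg_rnormP ul; apply/cvgrPdist_le => e e0.
have : (fun n => rnorm (l - u n) * rnorm y) @ \oo --> (0 : R).
  by rewrite -(mul0r (rnorm y)); apply: cvgMr_tmp.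
move=> /cvgrPdist_le/(_ _ e0); apply: filterS => n.
rewrite sub0r normrN ger0_norm ?mulr_ge0 ?rnorm_ge0//; apply: le_trans.
rewrite -ReN -ReD -dotBl; apply: le_trans (le_Re_rnorm _) _.
exact: rnorm_dot.
Qed.

(** * Synthesis and frame operator under an upper frame bound *)

Section Bessel.
Variables (phi : nat -> H) (B : R).
Hypothesis B_gt0 : 0 < B.
Hypothesis bessel :
  forall h, (sqsum (coefs dot phi h) <= (B * rnorm h ^+ 2)%:E)%E.

Local Notation synth c := (series (fun k => c k *: phi k)).

Lemma bessel_sum m n h :
  \sum_(m <= k < n) rnorm (dot h (phi k)) ^+ 2 <= B * rnorm h ^+ 2.
Proof. by rewrite -lee_fin (le_trans _ (bessel h))// sqsum_geP. Qed.

(** For the finite sum g, |g|^2 is the sum of the c_k <phi_k, g>. Splitting each product into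
    squares, the Bessel bound turns the part in g into at most |g|^2 / 2, which the left side
    absorbs. *)
Lemma synth_sum_le c m n :
  rnorm (\sum_(m <= k < n) c k *: phi k) ^+ 2
    <= B * \sum_(m <= k < n) rnorm (c k) ^+ 2.
Proof.
set g := \sum_(_ <= _ < _) _.
have gE : rnorm g ^+ 2 <= \sum_(m <= k < n) rnorm (c k) * rnorm (dot g (phi k)).
  have -> : rnorm g ^+ 2 = rnorm (dot g g).
    by apply: complexI; rewrite rnormE ger0_norm// rnorm_sqE.
  rewrite {1}/g dot_suml.
  apply: le_trans; first exact: rnorm_sum.
  by apply: ler_sum => k _; rewrite dotZl rnormM rnorm_dotC.
(* AM-GM: a b <= (B a^2 + b^2 / B) / 2 *)
have : \sum_(m <= k < n) rnorm (c k) * rnorm (dot g (phi k)) <=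
    \sum_(m <= k < n) (B / 2 * rnorm (c k) ^+ 2
                       + (2 * B)^-1 * rnorm (dot g (phi k)) ^+ 2).
  apply: ler_sum => k _; set a := rnorm _; set b := rnorm _.
  rewrite -subr_ge0 (_ : _ - _ = (B * a - b) ^+ 2 / (2 * B)).
    by rewrite divr_ge0 ?sqr_ge0// mulr_ge0 ?(ltW B_gt0).
  by field; rewrite gt_eqF.
rewrite big_split /= -!mulr_sumr => le2.
have le3 : (2 * B)^-1 * \sum_(m <= k < n) rnorm (dot g (phi k)) ^+ 2 <=
    rnorm g ^+ 2 / 2.
  rewrite (_ : _ / 2 = (2 * B)^-1 * (B * rnorm g ^+ 2)); last first.
    by field; rewrite gt_eqF.
  by rewrite ler_wpM2l ?bessel_sum// invr_ge0 mulr_ge0 ?(ltW B_gt0).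
by lra.
Qed.

Lemma is_cvg_synth c : (sqsum c < +oo)%E -> cvgn (synth c).
Proof.
move/sqsum_is_cvg/is_cvg_series_dominated; apply; first exact: B_gt0.
exact: synth_sum_le.
Qed.

Lemma synth_lim_le c g (M : R) :
  synth c @ \oo --> g -> (sqsum c <= M%:E)%E -> rnorm g ^+ 2 <= B * M.
Proof.
move=> cg cM; have /cvg_rnorm := cg; move=> cg'.
have cg2 : (fun n => rnorm (synth c n) ^+ 2) @ \oo --> rnorm g ^+ 2.
  by rewrite expr2; under eq_fun do rewrite expr2; exact: cvgM.
rewrite -(cvg_lim _ cg2)//; apply: limr_le.
  by apply/cvg_ex; exists (rnorm g ^+ 2).
apply: nearW => n; apply: le_trans (synth_sum_le _ _ _) _.
by rewrite ler_pM2l// -lee_fin (le_trans _ cM)// sqsum_geP.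
Qed.

(** The limit exists by the Bessel bound, see [cvg_frame_op], so the default value of [limn] never
    occurs. *)
Definition frame_op h : H := limn (synth (coefs dot phi h)).

Lemma cvg_frame_op h : synth (coefs dot phi h) @ \oo --> frame_op h.
Proof. by apply: is_cvg_synth; exact: le_lt_trans (bessel h) (ltry _). Qed.

Lemma frame_op_self_adjoint x y : dot (frame_op x) y = dot x (frame_op y).
Proof.
apply: dot_lim_eq (cvg_frame_op x) (cvg_frame_op y) _ => n.
rewrite dot_suml [RHS]dotC dot_suml rmorph_sum; apply: eq_bigr => k _.
by rewrite !dotZl rmorphM /= -!dotC mulrC.
Qed.

(** Holds for partial sums by linearity in the first argument, then in the limit. It turns the frame
    bounds into bounds on the quadratic form of the frame operator. *)
Lemma sqsum_coefs h :
  sqsum (coefs dot phi h) = (complex.Re (dot (frame_op h) h))%:E.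
Proof.
apply: sqsum_lim.
rewrite (_ : series _ =
    fun n => complex.Re (dot (synth (coefs dot phi h) n) h)).
  exact/cvg_Re_dot/cvg_frame_op.
apply/funext => n; rewrite dot_suml.
rewrite (_ : \sum_(_ <= _ < _) _ =
    (\sum_(0 <= k < n) rnorm (coefs dot phi h k) ^+ 2)%:C) //.
rewrite rmorph_sum; apply: eq_bigr => k _ /=.
by rewrite dotZl [dot _ h]dotC -normCK -rnormE -rmorphXn.
Qed.

(** The operator inequality S^2 <= B S, read off from the synthesis bound at the coefficients of
    [h]. *)
Lemma frame_op_le h : rnorm (frame_op h) ^+ 2 <=
  B * complex.Re (dot (frame_op h) h).
Proof. by apply: synth_lim_le (cvg_frame_op h) _; rewrite sqsum_coefs. Qed.

Lemma frame_op_bounded h : rnorm (frame_op h) <= B * rnorm h.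
Proof.
rewrite -(@ler_pXn2r _ 2)// ?nnegrE ?mulr_ge0 ?rnorm_ge0 ?(ltW B_gt0)//.
rewrite exprMn [B ^+ 2]expr2 -mulrA.
exact: synth_lim_le (cvg_frame_op h) (bessel h).
Qed.

(** This one form of linearity covers differences and S 0 = 0 (t = 1) as well as the Neumann step (t
    = -1/B). *)
Lemma frame_opBZ (t : R[i]) x y :
  frame_op (x - t *: y) = frame_op x - t *: frame_op y.
Proof.
apply/cvg_lim => //.
rewrite (_ : synth _ = fun n => synth (coefs dot phi x) n
                                - t *: synth (coefs dot phi y) n).
  by apply: cvgB; [|apply: cvgZl_tmp]; exact: cvg_frame_op.
apply/funext => n; rewrite /series /= scaler_sumr -sumrB; apply: eq_bigr.
by move=> k _; rewrite /coefs dotBl dotZl scalerBl scalerA.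
Qed.

(** * Inversion of the frame operator from the lower bound *)

Variable A : R.
Hypothesis A_gt0 : 0 < A.
Hypothesis lower :
  forall h, ((A * rnorm h ^+ 2)%:E <= sqsum (coefs dot phi h))%E.

Local Notation S := frame_op.

Lemma frame_op_coercive h : A * rnorm h ^+ 2 <= complex.Re (dot (S h) h).
Proof. by rewrite -lee_fin -sqsum_coefs. Qed.

Lemma frame_op_lower h : A * rnorm h <= rnorm (S h).
Proof.
have [->|h0] := eqVneq (rnorm h) 0; first by rewrite mulr0 rnorm_ge0.
have {}h0 : 0 < rnorm h by rewrite lt_def h0 rnorm_ge0.
rewrite -(@ler_pM2r _ (rnorm h))// -mulrA -expr2.
apply: le_trans (frame_op_coercive h) _.
by rewrite (le_trans (ler_norm _))// (le_trans (le_Re_rnorm _))// rnorm_dot.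
Qed.

(** By S^2 <= B S the quadratic term cancels at most half of the cross term -2/B Re<Sx, x>;
    coercivity bounds the other half by -(A/B) |x|^2. *)
Lemma frame_op_contraction x :
  rnorm (x - B^-1%:C *: S x) ^+ 2 <= (1 - A / B) * rnorm x ^+ 2.
Proof.
rewrite rnormBZ_sq.
have le1 : B^-1 ^+ 2 * rnorm (S x) ^+ 2 <= B^-1 * complex.Re (dot (S x) x).
  rewrite expr2 -mulrA ler_pM2l ?invr_gt0//.
  by rewrite mulrC ler_pdivrMr// mulrC frame_op_le.
have le2 : B^-1 * (A * rnorm x ^+ 2) <= B^-1 * complex.Re (dot (S x) x).
  by rewrite ler_pM2l ?invr_gt0// frame_op_coercive.
have -> : (1 - A / B) * rnorm x ^+ 2
    = rnorm x ^+ 2 - B^-1 * (A * rnorm x ^+ 2) by ring.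
by nra.
Qed.

Lemma frame_op_cvg u l : u @ \oo --> l -> (fun n => S (u n)) @ \oo --> S l.
Proof.
move=> /cvg_rnormP ul; apply/cvg_rnormP/cvgrPdist_le => e e0.
have : (fun n => B * rnorm (l - u n)) @ \oo --> (0 : R).
  by rewrite -(mulr0 B); apply: cvgMl_tmp.
move=> /cvgrPdist_le/(_ _ e0); apply: filterS => n.
rewrite !sub0r !normrN !ger0_norm ?mulr_ge0 ?rnorm_ge0 ?(ltW B_gt0)//.
apply: le_trans; have := frame_opBZ 1 l (u n).
by rewrite !scale1r => <-; exact: frame_op_bounded.
Qed.

(* Neumann series: [x = B^-1 sum_k (1 - B^-1 S)^k y] solves [S x = y]. *)
Lemma frame_op_surj y : exists x, S x = y.
Proof.
pose F x := x - B^-1%:C *: S x.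
pose r k := iter k F y.
(* Were 1 - A/B negative, [Num.sqrt] would return 0; [F_le] holds in either case because the root is
   monotone. *)
pose q := Num.sqrt (1 - A / B).
have q1 : `|q| < 1.
  rewrite ger0_norm ?sqrtr_ge0// -[ltRHS]sqrtr1 ltr_sqrt// ltrBlDr ltrDl.
  by rewrite divr_gt0.
have F_le x : rnorm (F x) <= q * rnorm x.
  rewrite -(ger0_norm (rnorm_ge0 (F x))) -(ger0_norm (rnorm_ge0 x)).
  rewrite -!sqrtr_sqr mulrC -sqrtrM ?sqr_ge0// ler_wsqrtr// mulrC.
  exact: frame_op_contraction.
have r_le k : rnorm (r k) <= geometric (rnorm y) q k.
  elim: k => [|k IH]; first by rewrite /= expr0 mulr1.
  apply: le_trans (F_le _) _; rewrite /= exprS mulrCA ler_wpM2l ?sqrtr_ge0//.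
have r_cvg : cvgn (series r).
  refine (is_cvg_series_dominated _ _ r _ 0%N 1
            (is_cvg_geometric_series q1) ltr01 _) => m n.
  rewrite expr1 mul1r; apply: le_trans; first exact: rnorm_sum.
  by apply: ler_sum => k _; exact: r_le.
pose X n := B^-1%:C *: series r n.
(* The sum telescopes: the residual after n terms is [r n] itself, which tends to 0 as the term of a
   convergent series. *)
have SX n : S (X n) = y - r n.
  elim: n => [|n IH].
    rewrite /X /series /= big_geq// scaler0 subrr.
    have := frame_opBZ 1 0 0; rewrite !scale1r !subrr; exact.
  rewrite (_ : X n.+1 = X n - (- B^-1%:C) *: r n).
    by rewrite frame_opBZ IH /= scaleNr opprK /F opprB addrA addrAC.
  by rewrite /X /series /= big_nat_recr//= scalerDr scaleNr opprK.
exists (B^-1%:C *: limn (series r)).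
have /frame_op_cvg SXl : X @ \oo --> B^-1%:C *: limn (series r).
  exact: cvgZl_tmp.
have Xy : (fun n => S (X n)) @ \oo --> y - 0.
  under eq_fun do rewrite SX.
  by apply: cvgB; [exact: cvg_cst|exact: cvg_series_cvg_0].
by rewrite subr0 in Xy; exact: cvg_unique SXl Xy.
Qed.

(** The correction to the canonical dual adds [a h * d n] to the coefficients of [h]. Since [d]
    synthesises to 0, reconstruction is unaffected; since [a h0 = 1], the coefficients of [h0]
    become exactly [c]. *)
Lemma dual_frame_prescribed c h0 :
  h0 != 0 -> (sqsum c < +oo)%E -> synth c @ \oo --> h0 ->
  exists2 phid, is_dual_frame dot phi phid & coefs dot phid h0 = c.
Proof.
move=> h0_neq0 c2 ch0.
(* [G] is a right inverse of S chosen pointwise; its bound and its symmetry follow from those of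
   S. *)
have [G SG] := choice frame_op_surj.
have G_le h : rnorm (G h) <= rnorm h / A.
  by rewrite ler_pdivlMr// mulrC -[in leRHS](SG h) frame_op_lower.
have dot_G h n : dot h (G (phi n)) = dot (G h) (phi n).
  by rewrite -[in LHS](SG h) frame_op_self_adjoint SG.
pose d : nat -> R[i] := c - coefs dot phi (G h0).
have [M dM] : exists M : R, sqsum d = M%:E.
  have : d \in @is_l2 R.
    case: (is_l2_zmod_closed R) => _; apply => //.
    exact: le_lt_trans (bessel _) (ltry _).
  move=> d2; exists (fine (sqsum d)); rewrite fineK//.
  by rewrite ge0_fin_numE ?sqsum_ge0.
have M0 : 0 <= M by rewrite -lee_fin -dM sqsum_ge0.
have d0 : synth d @ \oo --> (0 : H).
  rewrite -(subrr h0) -[X in _ - X]SG.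
  rewrite (_ : synth d = fun n => synth c n - synth (coefs dot phi (G h0)) n).
    by apply: cvgB => //; exact: cvg_frame_op.
  apply/funext => n; rewrite /series /= -sumrB; apply: eq_bigr => k _.
  exact: scalerBl.
pose a h := dot h h0 / dot h0 h0.
(* The conjugate compensates for the conjugate-linearity of [dot] in its second argument. *)
pose phid n := G (phi n) + Num.conj (d n / dot h0 h0) *: h0.
have phidE h : coefs dot phid h = coefs dot phi (G h) + (fun n => a h * d n).
  apply/funext => n; rewrite /coefs dotDr dot_G dotZr conjCK.
  by congr (_ + _); rewrite /a; ring.
have a_le h : rnorm (a h) <= rnorm h / rnorm h0.
  have h0_gt0 := rnorm_gt0 _ _ _ h0_neq0.
  rewrite ler_pdivlMr// -(ler_pM2r h0_gt0) -mulrA -expr2.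
  rewrite (_ : rnorm h0 ^+ 2 = rnorm (dot h0 h0)); last first.
    by apply: complexI; rewrite rnormE ger0_norm// rnorm_sqE.
  by rewrite -rnormM divfK ?dnorm_eq0// rnorm_dot.
have phid_synth h : synth (coefs dot phid h) @ \oo --> h.
  rewrite -[X in _ --> X]addr0 -(scaler0 _ (a h)) -[X in X + _]SG.
  rewrite (_ : synth _ = fun n => synth (coefs dot phi (G h)) n
                                  + a h *: synth d n).
    by apply: cvgD; [exact: cvg_frame_op|exact: cvgZl_tmp].
  apply/funext => n; rewrite /series /= scaler_sumr -big_split phidE.
  by apply: eq_bigr => k _; rewrite scalerA; exact: scalerDl.
exists phid; last first.
  rewrite phidE /a divff ?dnorm_eq0//; apply/funext => n.
  by rewrite -[LHS]/(coefs dot phi (G h0) n + 1 * d n) mul1r addrC subrK.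
split=> //.
(* The factors 2 come from [sqsumD_weighted] with equal weights, the quotients from [G_le] and
   [a_le]. *)
pose K := 2 * (B / A ^+ 2) + 2 * (M / rnorm h0 ^+ 2).
have phid_le h : (sqsum (coefs dot phid h) <= (K * rnorm h ^+ 2)%:E)%E.
  rewrite phidE; apply: le_trans (sqsumD_weighted _ _ ltr01 ltr01) _.
  rewrite sqsumZ dM divr1.
  apply: le_trans (leeD (lee_wpmul2l _ (bessel (G h))) (lexx _)) _ => //.
  rewrite -!EFinM -EFinD lee_fin /K [leRHS]mulrDl.
  apply: lerD.
    rewrite -!mulrA ler_pM2l// ler_pM2l// mulrC -expr_div_n.
    by rewrite ler_pXn2r ?nnegrE ?divr_ge0 ?rnorm_ge0 ?(ltW A_gt0).
  rewrite (_ : 2 * (M / _) * _ = 2 * (M * (rnorm h / rnorm h0) ^+ 2)).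
    rewrite ler_pM2l// [leLHS]mulrC ler_wpM2l//.
    by rewrite ler_pXn2r ?nnegrE ?divr_ge0 ?rnorm_ge0.
  by rewrite expr_div_n; ring.
(* The lower bound is the synthesis bound applied to the reconstruction of [h]. Adding 1/B to [K]
   puts the two constants in order. *)
exists B^-1, (K + B^-1); split.
- by rewrite invr_gt0.
- by rewrite lerDr addr_ge0// mulr_ge0// divr_ge0// ?exprn_ge0 ?rnorm_ge0// ltW.
move=> h; apply/andP; split; last first.
  apply: le_trans (phid_le h) _; rewrite lee_fin ler_wpM2r ?sqr_ge0// lerDl.
  by rewrite invr_ge0 ltW.
have fin : sqsum (coefs dot phid h) \is a fin_num.
  by rewrite ge0_fin_numE ?sqsum_ge0// (le_lt_trans (phid_le h)) ?ltry.
rewrite -(fineK fin) lee_fin ler_pdivrMl//.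
by apply: synth_lim_le (phid_synth h) _; rewrite fineK.
Qed.

End Bessel.
End Hilbert.

(** * Density of the analysis ranges, and recovery of a frame from its duals *)

Theorem theorem1p2 (R : realType) (H : completeNormedModType R[i])
    (dot : {dot H for (@Num.conj R[i])})
    (norm_dot : forall h : H, `|h| ^+ 2 = dot h h)
    (separable : exists2 D : set H, countable D & dense D)
    (nonzero : exists h : H, h != 0)
    (phi : nat -> H) (phi_frame : is_frame dot phi) :
  closure (\bigcup_(phid in [set phid | is_dual_frame dot phi phid])
             range (analysis dot phid)) = [set: l2 R]
  /\
  (forall psi : nat -> H, is_frame dot psi ->
     (forall phid : nat -> H,
        is_dual_frame dot phi phid -> is_dual_frame dot psi phid) ->
     psi = phi).
Proof.
have [A [B [A0 AB AphiB]]] := phi_frame.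
have B0 : 0 < B := lt_le_trans A0 AB.
have lower h : ((A * rnorm h ^+ 2)%:E <= sqsum (coefs dot phi h))%E.
  by case/andP: (AphiB h).
have bessel h : (sqsum (coefs dot phi h) <= (B * rnorm h ^+ 2)%:E)%E.
  by case/andP: (AphiB h).
have dual_prescribed :=
  dual_frame_prescribed _ _ _ norm_dot _ _ B0 bessel _ A0 lower.
(* If all [phi n] vanished, the lower bound would fail at a nonzero vector. *)
have [m phim] : exists m, phi m != 0.
  apply: contrapT => /forallNP phi0; have [h h0] := nonzero.
  have := lower h; rewrite (_ : coefs dot phi h = 0); last first.
    apply/funext => n; rewrite /coefs; have /negP := phi0 n.
    by rewrite negbK => /eqP ->; rewrite (dotC _ _ dot) linear0l rmorph0.
  rewrite sqsum0 lee_fin leNgt => /negP; apply.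
  by rewrite mulr_gt0// exprn_gt0// rnorm_gt0.
split.
- apply/seteqP; split=> // x _ N.
  move=> /nbhs_ballP[_ /= /gt0_complexP[r r0 ->] xrN].
  (* Such a [y] is the analysis of [h0] by a dual frame with prescribed coefficients. *)
  suff [y [xy [h0 h0_neq0 yh0]]] : exists y : l2 R, ball x r%:C y /\
      exists2 h0, h0 != 0 & series (fun k => y k *: phi k) @ \oo --> h0.
    have [phid phid_dual phid_y] := dual_prescribed _ _ h0_neq0 (l2P y) yh0.
    exists y; split; last exact: xrN.
    exists phid => //; exists h0 => //.
    by apply/val_inj; rewrite -[RHS]phid_y; exact: analysisE phid_dual.1.
  have [g xg] : exists g : H, series (fun k => x k *: phi k) @ \oo --> g.
    by apply/cvg_ex/(is_cvg_synth _ _ _ norm_dot _ _ B0 bessel)/l2P.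
  have [g0|g_neq0] := eqVneq g 0; last first.
    by exists x; split; [apply: ballxx; rewrite ltcR|exists g].
  (* If [x] synthesises to 0, adding r/2 times the unit vector at [m] stays in the ball and changes
     the synthesis to (r/2) [phi m], which is nonzero. *)
  have r2 : 0 < r / 2 by rewrite divr_gt0.
  have e_l2 : is_l2 (delta R m (r / 2)%:C) by rewrite /is_l2 sqsum_delta ltry.
  pose e : l2 R := L2 e_l2.
  exists (x + e); split.
    rewrite -ball_normE /= opprD addrA subrr add0r normrN.
    rewrite -[`|e|]/(l2_normC e) /l2_normC ltcR /l2_norm sqsum_delta /=.
    rewrite sqrtr_sqr ger0_norm ?rnorm_ge0// -ltcR rnormE.
    rewrite ger0_norm ?lecR ?(ltW r2)// ltcR ltr_pdivrMr//.
    by rewrite mulrDr mulr1 ltrDl.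
  exists ((r / 2)%:C *: phi m).
    by rewrite scaler_eq0 negb_or phim andbT gt_eqF ?ltcR.
  rewrite -[X in _ --> X]add0r -g0.
  rewrite (_ : series _ = fun n => series (fun k => x k *: phi k) n
      + series (fun k => delta R m (r / 2)%:C k *: phi k) n).
    by apply: cvgD => //; exact: cvg_synth_delta.
  apply/funext => n; rewrite /series /= -big_split; apply: eq_bigr => k _.
  exact: scalerDl.
- move=> psi psi_frame dual_psi.
  (* A dual frame of [phi] whose coefficients at [h0] are [c] is also dual to [psi], so [psi]
     rebuilds [h0] from the same [c]. *)
  have transfer c h0 : h0 != 0 -> (sqsum c < +oo)%E ->
      series (fun k => c k *: phi k) @ \oo --> h0 ->
      series (fun k => c k *: psi k) @ \oo --> h0.
    move=> h0_neq0 c2 ch0.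
    have [phid /dual_psi[_ /(_ h0)]] := dual_prescribed _ _ h0_neq0 c2 ch0.
    by move=> + <-.
  have delta_l2 n : (sqsum (delta R n 1%R) < +oo)%E by rewrite sqsum_delta ltry.
  have psi_eq n : phi n != 0 -> psi n = phi n.
    move=> phin; have := cvg_synth_delta _ _ phi n 1; rewrite scale1r.
    move=> /(transfer _ _ phin (delta_l2 n)) psi_phi.
    have := cvg_synth_delta _ _ psi n 1; rewrite scale1r => psi_psi.
    exact: cvg_unique psi_psi psi_phi.
  apply/funext => n; have [phin|/psi_eq//] := eqVneq (phi n) 0.
  (* When [phi n = 0], the unit vector at [n] lies in the kernel, where [transfer] says nothing.
     Adding the one at [m] leaves the kernel, and [psi m = phi m] then cancels. *)
  have sum_delta (xi : nat -> H) : series (fun k =>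
      (delta R n 1 + delta R m 1) k *: xi k) @ \oo --> xi n + xi m.
    rewrite (_ : series _ = fun N => series (fun k => delta R n 1 k *: xi k) N
                              + series (fun k => delta R m 1 k *: xi k) N).
      rewrite -[xi n]scale1r -[xi m]scale1r.
      by apply: cvgD; exact: cvg_synth_delta.
    apply/funext => N; rewrite /series /= -big_split; apply: eq_bigr => k _.
    exact: scalerDl.
  have psi_sum : series (fun k =>
      (delta R n 1 + delta R m 1) k *: psi k) @ \oo --> phi n + phi m.
    apply: (transfer _ _ _ _ (sum_delta phi)); first by rewrite phin add0r.
    apply: le_lt_trans (sqsumD_weighted _ _ ltr01 ltr01) _.
    by rewrite !sqsum_delta ltry.
  apply: (addIr (psi m)); rewrite [in RHS](psi_eq _ phim).
  exact: cvg_unique (sum_delta psi) psi_sum.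
Qed.
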